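(* Let $k$ be a field of characteristic zero, let $\overline{\mathbb{N}}=\mathbb{N}\cup\{-\infty\}$ be the monoid with operation $\max$, let $H=k\overline{\mathbb{N}}$ be its monoid algebra, and let $\underline{\mathbb{N}}=\mathbb{N}\cup\{+\infty\}\cup\{-\infty\}$. Let $O=\{f_n\mid n\in\underline{\mathbb{N}}\}$, where for $n\in\overline{\mathbb{N}}$ the linear map $f_n:H\to k$ is given by $f_n(m)=0$ if $m>n$ and $f_n(m)=1$ otherwise ($m\in\overline{\mathbb{N}}$), and $f_{+\infty}(m)=1$ for all $m\in\overline{\mathbb{N}}$. Then $O=\mathrm{Alg}(H,k)$, and $(O,\cdot)\cong(\underline{\mathbb{N}},\min)$ as monoids.
   Context: $\mathrm{Alg}(H,k)$ denotes the monoid of (unital) algebra homomorphisms $H\to k$. The product $\cdot$ is the pointwise multiplication of functions on $\overline{\mathbb{N}}$ (linear maps on $H$ are identified with functions on the basis $\overline{\mathbb{N}}$ of $H$). The identity of $(\overline{\mathbb{N}},\max)$ is $-\infty$. *)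

(* Defs.v *)
From HB Require Import structures.
From mathcomp Require Import all_boot all_order all_algebra.
From mathcomp Require Import finmap boolp classical_sets functions.
From mathcomp.multinomials Require Import monalg.

Set Implicit Arguments.
Unset Strict Implicit.
Unset Printing Implicit Defensive.

Import Order.TTheory GRing.Theory.

Local Open Scope ring_scope.

(* N u {-oo} *)
Variant Nbar := NInf | NFin of nat.

Definition Nbar_code (x : Nbar) : option nat :=
  if x is NFin n then Some n else None.
Definition Nbar_decode (o : option nat) : Nbar :=
  if o is Some n then NFin n else NInf.
Lemma Nbar_codeK : cancel Nbar_code Nbar_decode. Proof. by case. Qed.
HB.instance Definition _ := Countable.copy Nbar (can_type Nbar_codeK).

Definition Nbar_le (x y : Nbar) : bool :=
  match x, y with
  | NInf, _ => true
  | NFin _, NInf => false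
  | NFin m, NFin n => (m <= n)%N
  end.

Lemma Nbar_le_refl : reflexive Nbar_le.
Proof. by case=> //= n; apply: leqnn. Qed.
Lemma Nbar_le_anti : antisymmetric Nbar_le.
Proof. by case=> [|m] [|n] //= mn; congr NFin; apply: anti_leq. Qed.
Lemma Nbar_le_trans : transitive Nbar_le.
Proof. by case=> [|n] [|m] [|p] //=; apply: leq_trans. Qed.
Lemma Nbar_le_total : total Nbar_le.
Proof. by case=> [|m] [|n] //=; apply: leq_total. Qed.

HB.instance Definition _ := Order.Le_isPOrder.Build (Order.Disp tt tt) Nbar
  Nbar_le_refl Nbar_le_anti Nbar_le_trans.
HB.instance Definition _ :=
  Order.POrder_isTotal.Build (Order.Disp tt tt) Nbar Nbar_le_total.

Lemma Nbar_maxNx : left_id NInf (Order.max : Nbar -> Nbar -> Nbar).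
Proof. by move=> x; apply/max_idPr. Qed.
Lemma Nbar_maxxN : right_id NInf (Order.max : Nbar -> Nbar -> Nbar).
Proof. by move=> x; apply/max_idPl. Qed.
Lemma Nbar_max_eqN (x y : Nbar) : Order.max x y = NInf -> x = NInf /\ y = NInf.
Proof. by rewrite maxEle; case: x y => [|m] [|n] //; case: ifP. Qed.

(* The product of the monoid Nbar is max and its identity is -oo; the
   monoid algebra below is built from this structure. *)
HB.instance Definition _ := Choice_isMonomialDef.Build Nbar
  (@maxA _ Nbar) Nbar_maxNx Nbar_maxxN Nbar_max_eqN.
HB.instance Definition _ := MonomialDef_isConomialDef.Build Nbar (@maxC _ Nbar).

(* N u {-oo} u {+oo}, as Nbar with a point +oo added *)
Variant Nunder := Fin of Nbar | PInf.

Definition Nunder_code (x : Nunder) : option Nbar :=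
  if x is Fin n then Some n else None.
Definition Nunder_decode (o : option Nbar) : Nunder :=
  if o is Some n then Fin n else PInf.
Lemma Nunder_codeK : cancel Nunder_code Nunder_decode. Proof. by case. Qed.
HB.instance Definition _ := Countable.copy Nunder (can_type Nunder_codeK).

Definition Nunder_le (x y : Nunder) : bool :=
  match x, y with
  | _, PInf => true
  | PInf, Fin _ => false
  | Fin m, Fin n => (m <= n)%O
  end.

Lemma Nunder_le_refl : reflexive Nunder_le.
Proof. by case=> //= n; apply: lexx. Qed.
Lemma Nunder_le_anti : antisymmetric Nunder_le.
Proof. by case=> [m|] [n|] //= mn; congr Fin; apply: le_anti. Qed.
Lemma Nunder_le_trans : transitive Nunder_le.
Proof. by case=> [n|] [m|] [p|] //=; apply: le_trans. Qed.
Lemma Nunder_le_total : total Nunder_le.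
Proof. by case=> [m|] [n|] //=; apply: le_total. Qed.

HB.instance Definition _ := Order.Le_isPOrder.Build (Order.Disp tt tt) Nunder
  Nunder_le_refl Nunder_le_anti Nunder_le_trans.
HB.instance Definition _ :=
  Order.POrder_isTotal.Build (Order.Disp tt tt) Nunder Nunder_le_total.

Lemma Nunder_le_PInf (x : Nunder) : (x <= PInf)%O.
Proof. by case: x. Qed.
Lemma Nunder_minPx : left_id PInf (Order.min : Nunder -> Nunder -> Nunder).
Proof. by move=> x; apply/min_idPr/Nunder_le_PInf. Qed.
Lemma Nunder_minxP : right_id PInf (Order.min : Nunder -> Nunder -> Nunder).
Proof. by move=> x; apply/min_idPl/Nunder_le_PInf. Qed.

HB.instance Definition _ :=
  isMonoid.Build Nunder (@minA _ Nunder) Nunder_minPx Nunder_minxP.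

Section Dual.
Variable k : fieldType.

(* The monoid algebra of Nbar; the basis element m is << m >>. *)
Definition Hk := {malg k[Nbar]}.

Definition ext (phi : Nbar -> k) (h : Hk) : k :=
  \sum_(m <- msupp h) h@_m * phi m.

Lemma ext_is_linear phi : scalar (ext phi).
Proof.
move=> a x y; pose d := (msupp x `|` msupp y `|` msupp (a *: x + y))%fset.
have extw (h : Hk) : (msupp h `<=` d)%fset -> ext phi h = \sum_(m <- d) h@_m * phi m.
  exact: (@mmapEw _ _ _ idfun phi d h).
have [sx sy sz] : [/\ (msupp x `<=` d)%fset, (msupp y `<=` d)%fset
    & (msupp (a *: x + y) `<=` d)%fset].
  split; last exact: fsubsetUr.
    by rewrite /d -fsetUA fsubsetUl.
  exact: fsubset_trans (fsubsetUr _ _) (fsubsetUl _ _).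
rewrite !extw // mulr_sumr -big_split /=; apply: eq_bigr => m _.
by rewrite mcoeffD mcoeffZ mulrDl mulrA.
Qed.

HB.instance Definition _ phi :=
  GRing.isLinear.Build k Hk k *%R (ext phi) (ext_is_linear phi).

(* Linear maps H -> k; monoidType requires a choiceType, obtained classically *)
Definition Hdual := {scalar Hk}.
HB.instance Definition _ := gen_eqMixin Hdual.
HB.instance Definition _ := gen_choiceMixin Hdual.

Definition linext (phi : Nbar -> k) : Hdual := ext phi.

Lemma linextU phi m : linext phi << m >> = phi m.
Proof.
by rewrite /= /ext msuppU oner_eq0 big_seq_fset1 mcoeffUU mul1r.
Qed.

Lemma HdualP (f g : Hdual) : (forall m, f << m >> = g << m >>) -> f = g.
Proof.
move=> fg; have: GRing.Linear.sort f = GRing.Linear.sort g.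
  apply/funext => h; rewrite (monalgE h) !linear_sum; apply: eq_bigr => m _.
  have -> : << h@_m *g m >> = h@_m *: << m >> :> Hk.
    by apply/malgP => p; rewrite mcoeffZ !mcoeffU mulrnAr mulr1.
  by rewrite !linearZ /= fg.
case: f g {fg} => [f [fa fb]] [g [ga gb]] /= fg.
move: fa fb; rewrite {}fg => fa fb.
have -> : fa = ga by case: fa ga => ? [?]; congr (_ _); exact: Prop_irrelevance.
by have -> : fb = gb by case: fb gb => ? [?]; congr (_ _); exact: Prop_irrelevance.
Qed.

(* Pointwise product of linear maps, viewed as functions on Nbar *)
Definition pwmul (f g : Hdual) : Hdual :=
  linext (fun m => f << m >> * g << m >>).
Definition pwone : Hdual := linext (fun=> 1).

Lemma pwmulA : associative pwmul.
Proof. by move=> f g h; apply: HdualP => m; rewrite !linextU mulrA. Qed.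
Lemma pwmul1f : left_id pwone pwmul.
Proof. by move=> f; apply: HdualP => m; rewrite !linextU mul1r. Qed.
Lemma pwmulf1 : right_id pwone pwmul.
Proof. by move=> f; apply: HdualP => m; rewrite !linextU mulr1. Qed.

HB.instance Definition _ := isMonoid.Build Hdual pwmulA pwmul1f pwmulf1.

Definition Alg : set Hdual := [set f | GRing.monoid_morphism f].

Definition f_ (n : Nunder) : Hdual :=
  match n with
  | Fin n => linext (fun m => if (n < m)%O then 0 else 1)
  | PInf => linext (fun=> 1)
  end.

Definition Oset : set Hdual := range f_.
End Dual.

Arguments Alg k : clear implicits.
Arguments Oset k : clear implicits.

(* Main.v *)
Require Import Defs.
From HB Require Import structures.
From mathcomp Require Import all_boot all_order all_algebra.
From mathcomp Require Import finmap boolp classical_sets functions.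
From mathcomp.multinomials Require Import monalg.

Import Order.TTheory GRing.Theory.

Local Open Scope ring_scope.

(** An algebra map out of a monoid algebra is the same thing as a monoid map
    from the monoid to the multiplicative monoid of [k], here a function [phi]
    on [Nbar] with [phi NInf = 1] that turns [max] into a product ([AlgP]).  As [max] is
    idempotent, every value of [phi] is an idempotent of the field, hence [0]
    or [1]; and [phi] is antitone, because [max m n = n] for [m <= n] forces
    [phi n = phi m * phi n].  So [phi] is the indicator function of a nonempty
    initial segment of [Nbar], and by well-foundedness of the natural numbers
    such a segment is [{m | m <= n}] for some [n] in [Nunder]
    ([Nbar_character_step]): either it is everything, or the least point outside
    it has a predecessor, which is [n].

    Once each [f_ n] is read as the indicator function of [{m | m <= n}]
    ([f_U]), the remaining claims are about initial segments.  The pointwise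
    product intersects them, and intersecting them takes the [min] of the end
    points ([f_min]); the end point can be recovered from the segment
    ([f_inj]). *)

(** This turns computations with [f_] into computations with initial segments:
    products of values become conjunctions of inequalities in [Nunder]. *)
Lemma f_U (k : fieldType) (n : Nunder) (m : Nbar) :
  f_ k n << m >> = (Fin m <= n)%O%:R.
Proof.
case: n => [n|]; rewrite /f_ linextU //.
have -> : (Fin m <= Fin n)%O = (m <= n)%O by [].
by case: leP.
Qed.

Lemma f_min (k : fieldType) (n p : Nunder) :
  f_ k (Order.min n p) = (f_ k n * f_ k p)%g.
Proof.
apply: HdualP => m; rewrite (linextU _ m : (f_ k n * f_ k p)%g << m >> = _).
by rewrite !f_U le_min -natrM mulnb.
Qed.

(** The end points [n] and [p] are compared by evaluating at each of them; as
    [PInf] is not a point of [Nbar], it is told apart from [Fin n] by the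
    successor of [n]. *)
Lemma f_inj (k : fieldType) : injective (f_ k).
Proof.
have leE (n p : Nunder) : f_ k n = f_ k p -> forall m, (Fin m <= n)%O = (Fin m <= p)%O.
  move=> np m; have /eqP := congr1 (fun f : Hdual k => f << m >>) np.
  rewrite /= !f_U; do 2!case: (_ <= _)%O => //.
    by rewrite oner_eq0.
  by rewrite eq_sym oner_eq0.
have notPInf (n : Nbar) : ~ (forall m, (Fin m <= Fin n)%O).
  case: n => [/(_ (NFin 0))|n /(_ (NFin n.+1))] //.
  by move=> /(leq_trans (ltnSn n)); rewrite ltnn.
move=> n p /leE; case: n p => [n|] [p|] // np.
- apply: le_anti.
  by have := np n; have := np p; rewrite !lexx => -> <-.
- by case: (notPInf n) => m; rewrite np.
- by case: (notPInf p) => m; rewrite -np.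
Qed.

(** Both sides of multiplicativity are bilinear, so it is enough to check it
    on the basis. *)
Lemma AlgP (k : fieldType) (f : Hdual k) :
  Alg k f <-> f << NInf >> = 1 /\
    (forall m n, f << Order.max m n >> = f << m >> * f << n >>).
Proof.
have UM (m n : Nbar) : << m >> * << n >> = << Order.max m n >> :> Hk k.
  by rewrite -[1 in RHS]mulr1; exact: fgmulUU.
have UZ c m : << c *g m >> = c *: << m >> :> Hk k.
  by apply/malgP => p; rewrite mcoeffZ !mcoeffU mulrnAr mulr1.
split=> [[f1 fM] | [f1 fM]].
  by split=> // m n; rewrite -fM UM.
split=> // x y.
have fU m n : f << x@_m * y@_n *g mmul m n >>
    = f << x@_m *g m >> * f << y@_n *g n >>.
  by rewrite (UZ (x@_m * y@_n)) (UZ x@_m) (UZ y@_n) !linearZ /= fM mulrACA.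
rewrite malgME [x in RHS]monalgE [y in RHS]monalgE.
rewrite !linear_sum mulr_suml; apply: eq_bigr => m _.
by rewrite linear_sum mulr_sumr; apply: eq_bigr => n _; exact: fU.
Qed.

(** The support of [phi] is an initial segment of [Nbar] on which [phi] is [1].
    If some [NFin j] is outside it, the least such [j] determines it, and its
    end point is the predecessor of [NFin j]; this is [NInf] when [j = 0], which
    is in the support because [phi NInf = 1]. *)
Lemma Nbar_character_step (R : idomainType) (phi : Nbar -> R) :
    phi NInf = 1 -> (forall m n, phi (Order.max m n) = phi m * phi n) ->
  exists n : Nunder, forall m, phi m = (Fin m <= n)%O%:R.
Proof.
move=> phi1 phiM.
have phi01 m : phi m != 0 -> phi m = 1.
  move=> nz; apply: (mulfI nz); rewrite mulr1 -phiM; congr phi.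
  exact: maxxx.
have phi0 i j : (i <= j)%N -> phi (NFin i) = 0 -> phi (NFin j) = 0.
  move=> ij i0; have <- : Order.max (NFin i) (NFin j) = NFin j by apply/max_idPr.
  by rewrite phiM i0 mul0r.
have [|nz] := pselect (exists j, phi (NFin j) == 0).
  case/ex_minnP=> j /eqP j0 jmin.
  exists (Fin (if j is i.+1 then NFin i else NInf)) => -[|i].
    by rewrite phi1; case: (j).
  have -> : (Fin (NFin i) <= Fin (if j is l.+1 then NFin l else NInf))%O
      = (i < j)%N by case: (j).
  case: ltnP => [ij | ji]; last exact: phi0 j0.
  apply: phi01; apply/negP => /jmin.
  by rewrite leqNgt ij.
exists PInf => m; apply: phi01; case: m => [|j]; first by rewrite phi1 oner_eq0.
by apply/negP => j0; apply: nz; exists j.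
Qed.

Theorem proposition4p3 (k : fieldType) (k_char0 : [pchar k] =i pred0) :
  Oset k = Alg k /\
  monoid_closed [in Oset k] /\
  exists phi : UMagmaMorphism.type Nunder (Hdual k),
    set_bij setT (Oset k) phi.
Proof.
have f1 : f_ k 1%g = 1%g by [].
have fM : {morph f_ k : n p / (n * p)%g} by exact: f_min.
split; last split.
- apply/seteqP; split=> f.
    case=> n _ <-; apply/AlgP; split; first by rewrite f_U; case: n.
    move=> m p; rewrite !f_U -natrM mulnb; congr (nat_of_bool _)%:R.
    by case: n => [n|] //; exact: ge_max.
  case/AlgP=> /(Nbar_character_step k (fun m => f << m >>)) /[apply] -[n fn].
  by exists n => //; apply: HdualP => m; rewrite f_U fn.
- split; first by apply/mem_set; exists 1%g.
  move=> f g /set_mem[n _ <-] /set_mem[p _ <-].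
  by apply/mem_set; exists (n * p)%g; rewrite ?fM.
- pose fmix := isUMagmaMorphism.Build Nunder (Hdual k) (f_ k) (f1, fM).
  pose phi : UMagmaMorphism.type Nunder (Hdual k) :=
    HB.pack (f_ k) fmix.
  exists phi; split=> [n _ | n p _ _ | f [n _ <-]].
  + by exists n.
  + exact: f_inj.
  + by exists n.
Qed.
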